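(* Let $d$ be a nonnegative integer and let $H_2(x)=(x+1)^{d+1}-x^{d+1}\in\mathbb{R}[x]$. If $H_2$ is written in the form $$H_2(x)=\sum_{i=1}^l \beta_i (x+y_i)^{e_i}$$ with real constants $\beta_i,y_i$ and nonnegative integers $e_i \leq d$ for every $i$, then $l > (d-1)/2$. *)

(* Defs.v *)
From HB Require Import structures.
From mathcomp Require Import all_boot all_order all_algebra.
From mathcomp Require Import reals.

Set Implicit Arguments.
Unset Strict Implicit.
Unset Printing Implicit Defensive.

Import GRing.Theory.
Local Open Scope ring_scope.

Definition H2 (R : realType) (d : nat) : {poly R} :=
  ('X + 1) ^+ d.+1 - 'X ^+ d.+1.

(* Main.v *)
Require Import Defs.
From HB Require Import structures.
From mathcomp Require Import all_boot all_order all_algebra.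
From mathcomp Require Import polyorder polyrcf zify.
From mathcomp Require Import reals.

(** By apolarity, [p.[1] = p.[0]] for every polynomial [p] of degree at most
    [d + 1] such that [p^`(d + 1 - e i)] vanishes at [y i] for all [i].  Cover
    these [l] conditions by at most [l] disjoint pairs of conditions of the
    form [p^`(k).[x] = p^`(k + 1).[x] = 0].  By linear algebra, some nonzero
    [p] with [p.[0] = 0] satisfies all the pairs, and its degree [n] is at
    most the number of these conditions of order less than [n]; in particular
    [n <= 2 l + 1].

    Let [N q] be the number of real zeros of [q], with multiplicities.  Rolle's
    theorem gives [N q - 1 <= N q^`()].  As the zeros it provides between the
    zeros of [q] are sign changes of [q^`()], hence of odd multiplicity, the
    right-hand side can be decreased by the even part of the multiplicity of
    every zero of [q^`()] that is not a zero of [q].  Summing over the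
    successive derivatives of [p], as in the theorem of Atkinson and Sharma on
    Birkhoff interpolation, one finds that the zeros of [p] and the conditions
    of order less than [n] in the pairs are at most [n] in number.  Hence [0]
    is the only zero of [p], so [p.[1] != p.[0]] and [d + 1 < n <= 2 l + 1]. *)

Set Implicit Arguments.
Unset Strict Implicit.
Unset Printing Implicit Defensive.

Import Order.TTheory GRing.Theory Num.Theory.
Local Open Scope ring_scope.

(** * The apolar pairing *)

Lemma derivn_XaddC_exp (R : comNzRingType) (a : R) (e i : nat) :
  (('X + a%:P) ^+ e)^`(i) = ('X + a%:P) ^+ (e - i) *+ e ^_ i.
Proof.
elim: i => [|i IHi]; first by rewrite subn0 ffactn0.
rewrite derivnS IHi derivMn deriv_exp derivD derivX derivC addr0 mul1r.
by rewrite -mulrnA mulnC -ffactnSr subnS.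
Qed.

Definition apolar (R : comNzRingType) (n : nat) (p q : {poly R}) : R :=
  \sum_(i < n.+1) p^`(n - i).[0] * q^`(i).[0].

Fact apolar_is_linear (R : comNzRingType) (n : nat) (p : {poly R}) :
  linear_for *%R (apolar n p).
Proof.
move=> c q r; rewrite /apolar mulr_sumr -big_split; apply: eq_bigr => i _ /=.
by rewrite linearP hornerD hornerZ mulrDr mulrCA.
Qed.

HB.instance Definition _ (R : comNzRingType) (n : nat) (p : {poly R}) :=
  GRing.isLinear.Build R {poly R} R *%R (apolar n p) (apolar_is_linear n p).

Lemma apolar_XaddC_exp (R : comNzRingType) (n e : nat) (p : {poly R}) (a : R) :
    (e <= n)%N -> (size p <= n.+1)%N ->
  apolar n p (('X + a%:P) ^+ e) = e`!%:R * p^`(n - e).[a].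
Proof.
move=> le_en le_pn.
have le_dp : (size p^`(n - e) <= e.+1)%N.
  apply/leq_sizeP => j le_ej; rewrite coef_derivn nth_default ?mul0rn //.
  by apply: leq_trans le_pn _; lia.
rewrite /apolar (bigID (fun i : 'I_n.+1 => i < e.+1)%N) /= addrC big1 => [|i].
  rewrite add0r (big_ord_narrow (le_en : e < n.+1)%N).
  rewrite (horner_coef_wide a le_dp) mulr_sumr.
  rewrite [RHS](reindex_inj rev_ord_inj) /=; apply: eq_bigr => i _.
  have le_ie : (i <= e)%N by rewrite -ltnS.
  rewrite derivn_XaddC_exp hornerMn horner_exp !hornerE subSS.
  have -> : (n - i = (e - i) + (n - e))%N by lia.
  rewrite /derivn iterD -!/(derivn _ _) horner_coef0 coef_derivn addn0 ffactnn.
  by rewrite mulrnAl mulrnAr -mulrnA ffact_fact // -[RHS]mulrA mulr_natl.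
rewrite -leqNgt => lt_ei.
by rewrite derivn_XaddC_exp ffact_small // mulr0n horner0 mulr0.
Qed.

Lemma eq_horner_shifted_powers (R : numDomainType) (I : finType) (n : nat)
    (a b : R) (beta y : I -> R) (e : I -> nat) (p : {poly R}) :
    ('X + a%:P) ^+ n - ('X + b%:P) ^+ n
      = \sum_i beta i *: ('X + (y i)%:P) ^+ e i ->
    (forall i, (e i <= n)%N) -> (size p <= n.+1)%N ->
    (forall i, root p^`(n - e i) (y i)) ->
  p.[a] = p.[b].
Proof.
move=> /(congr1 (apolar n p)) powersE le_en le_pn p_root.
have n_fact0 : n`!%:R != 0 :> R by rewrite pnatr_eq0 -lt0n fact_gt0.
apply/(mulfI n_fact0)/eqP; rewrite -subr_eq0; apply/eqP; move: powersE.
rewrite linearB /= !apolar_XaddC_exp // subnn => ->.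
rewrite linear_sum big1 // => i _.
by rewrite linearZ /= apolar_XaddC_exp // (rootP (p_root i)) !mulr0.
Qed.

(** * Polynomials with prescribed zeros of derivatives *)

Definition birkhoff_root (R : nzRingType) (cs : seq (R * nat)) (p : {poly R}) :=
  all (fun c => root p^`(c.2) c.1) cs.

Lemma exists_birkhoff_root_size_le (R : fieldType) (n : nat)
    (cs : seq (R * nat)) :
    (size cs < n)%N ->
  exists p : {poly R}, [/\ p != 0, (size p <= n)%N & birkhoff_root cs p].
Proof.
move=> lt_cs; pose c := tnth (in_tuple cs).
pose M := \matrix_(i < n, j < size cs) ('X^i)^`((c j).2).[(c j).1] : 'M[R]__.
have : kermx M != 0.
  rewrite -mxrank_eq0 mxrank_ker subn_eq0 -ltnNge.
  exact: leq_ltn_trans (rank_leq_col M) lt_cs.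
case/rowV0Pn => v /sub_kermxP vM0 v0; exists (rVpoly v); split.
- by rewrite raddf_eq0 //; apply: can_inj rVpolyK.
- exact: size_poly.
apply/(all_tnthP (t := in_tuple cs)) => j.
rewrite rootE; move/rowP/(_ j): vM0; rewrite !mxE => <-.
rewrite [X in rVpoly X]row_sum_delta !linear_sum /= horner_sum.
by apply/eqP/eq_bigr => i _; rewrite !linearZ /= hornerZ rVpoly_delta mxE.
Qed.

Lemma exists_birkhoff_root_deg_le_count (R : fieldType) (cs : seq (R * nat)) :
  exists p : {poly R}, [/\ p != 0, birkhoff_root cs p
    & ((size p).-1 <= count (fun c => c.2 < (size p).-1) cs)%N].
Proof.
pose low m := [seq c <- cs | (c.2 < m)%N].
have exm : exists m, (size (low m) < m)%N.
  by exists (size cs).+1; rewrite ltnS size_filter count_size.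
case: (ex_minnP exm) => m lt_m min_m.
have [p [p0 le_pm p_low]] := exists_birkhoff_root_size_le lt_m.
exists p; split => //.
  apply/allP => c c_cs; have [le_mc|lt_cm] := leqP m c.2.
    by rewrite poly.derivn_poly0 ?root0 // (leq_trans le_pm).
  by apply: (allP p_low); rewrite mem_filter lt_cm.
rewrite -size_filter leqNgt; apply/negP => /min_m.
by move: p0; rewrite -size_poly_gt0; lia.
Qed.

(** * Covering conditions by pairs of consecutive orders *)

Lemma count_sum T (a : pred T) (s : seq T) : count a s = (\sum_(x <- s) a x)%N.
Proof. by rewrite -sumn_count sumnE big_map. Qed.

Definition spaced (J : pred nat) := forall k, J k -> ~~ J k.+1.

Fixpoint pair_start (S : pred nat) (k : nat) : bool :=
  S k && (if k is j.+1 then ~~ pair_start S j else true).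

Lemma pair_start_sub (S : pred nat) (k : nat) : pair_start S k -> S k.
Proof. by case: k => [|k] /andP[]. Qed.

Lemma spaced_pair_start (S : pred nat) : spaced (pair_start S).
Proof. by move=> k k_start; rewrite /= k_start andbF. Qed.

Lemma pair_start_cover (S : pred nat) (k : nat) :
  S k -> pair_start S k \/ exists2 j, k = j.+1 & pair_start S j.
Proof.
case: k => [|k] /= Sk; first by left; rewrite Sk.
by case: (boolP (pair_start S k)) => [|_]; [right; exists k | left; rewrite Sk].
Qed.

Section PairCover.
Variable A : eqType.
Implicit Types K T : seq (A * nat).

Definition column T (x : A) : pred nat := fun k => (x, k) \in T.

Definition doubled T := T ++ [seq (t.1, t.2.+1) | t <- T].

Lemma pair_cover K : exists T, [/\ uniq T, {subset T <= K},
  forall x, spaced (column T x) & {subset K <= doubled T}].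
Proof.
pose T := [seq u <- undup K | pair_start (column K u.1) u.2].
have mem_T x k : ((x, k) \in T) = pair_start (column K x) k.
  rewrite mem_filter mem_undup andb_idr //; exact: pair_start_sub.
exists T; split=> [||x k|[x k] Kxk].
- by rewrite filter_uniq ?undup_uniq.
- by move=> u; rewrite mem_filter mem_undup => /andP[].
- by rewrite /column !mem_T; apply: spaced_pair_start.
rewrite mem_cat mem_T.
have [->//|[j -> j_start]] := pair_start_cover (S := column K x) Kxk.
by apply/orP; right; apply/mapP; exists (x, j); rewrite ?mem_T.
Qed.

Lemma count_le_sum_column T (Y : seq A) (n : nat) :
    uniq T -> {subset map fst T <= Y} ->
  (count (fun t => t.2 < n) T <= \sum_(x <- Y) \sum_(k < n) column T x k)%N.
Proof.
move=> uT TY.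
have -> : (\sum_(x <- Y) \sum_(k < n) column T x k
    = count (mem T) [seq (x, k) | x <- Y, k <- index_iota 0 n])%N.
  by rewrite count_sum big_allpairs; apply: eq_bigr => x _; rewrite big_mkord.
rewrite -!size_filter; apply: uniq_leq_size; first exact: filter_uniq.
move=> [x k]; rewrite !mem_filter /= => /andP[lt_kn Txk]; rewrite Txk.
by rewrite allpairs_f ?mem_index_iota // TY // (map_f fst Txk).
Qed.

End PairCover.

(** * Counting zeros of derivatives *)

Section BirkhoffMultiplicity.
Variable R : realDomainType.
Implicit Types (p : {poly R}) (x : R).

Definition even_run_mu x p : nat :=
  if root p x then 0%N else (\mu_x p^`())./2.*2.

(* A maximal run of consecutive orders [m, ..., m + k - 1] of derivatives of
   [p] vanishing at [x] contributes [k] if [m = 0], and [2 * (k / 2)] if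
   [m > 0]. *)
Definition birkhoff_mu x p : nat :=
  \mu_x p + \sum_(m < (size p).-1) even_run_mu x p^`(m).

Lemma birkhoff_mu_deriv x p : p != 0 ->
  (birkhoff_mu x p + (~~ root p x && odd (\mu_x p^`()))
     = birkhoff_mu x p^`() + root p x)%N.
Proof.
move=> p0; rewrite /birkhoff_mu size_deriv.
case def_n: (size p).-1 => [|n] /=.
  have /size_poly1P[c c0 ->] : size p == 1%N by rewrite polySpred ?def_n.
  by rewrite derivC mu0 mu_polyC rootC (negPf c0) !big_ord0.
rewrite big_ord_recl; under [in LHS]eq_bigr do rewrite lift0 derivSn.
rewrite {1}/even_run_mu derivn0; have [root_x|nroot_x] := boolP (root p x).
  have -> : \mu_x p = (\mu_x p^`() + 1)%N by apply: mu_deriv_root.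
  by rewrite addn0 add0n addnAC.
rewrite muNroot // add0n addn0 addnAC; congr (_ + _)%N.
by rewrite addnC odd_double_half.
Qed.

Lemma odd_birkhoff_mu x p : odd (birkhoff_mu x p) = odd (\mu_x p).
Proof.
rewrite oddD [odd (\sum_(_ < _) _)](_ : _ = false) ?addbF //.
apply: (big_ind (fun k => odd k = false)) => // [k l|m _].
  by rewrite oddD => -> ->.
by rewrite /even_run_mu; case: ifP => // _; rewrite odd_double.
Qed.

Lemma spaced_pairs_le_birkhoff_mu (J : pred nat) x p :
    p != 0 -> spaced J ->
    (forall k, J k -> root p^`(k) x /\ root p^`(k.+1) x) ->
  ((root p x && ~~ J 0%N) + 2 * \sum_(k < size p) J k <= birkhoff_mu x p)%N.
Proof.
move=> p0; rewrite polySpred //; move def_n: (size p).-1 => n.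
elim: n => [|n IHn] in J p p0 def_n * => spJ J_root.
  have /size_poly1P[c c0 pE] : size p == 1%N by rewrite polySpred ?def_n.
  have nroot_x : ~~ root p x by rewrite pE rootC.
  have nJ0 : J 0%N = false by apply: contraNF nroot_x => /J_root[].
  by rewrite (negPf nroot_x) big_ord1 nJ0.
rewrite big_ord_recl; under eq_bigr do rewrite lift0.
have dp0 : p^`() != 0 by rewrite -size_poly_gt0 size_deriv def_n.
have : ((root p^`() x && ~~ J 1) + 2 * \sum_(k < n.+1) J k.+1
    <= birkhoff_mu x p^`())%N.
  apply: (IHn (fun k => J k.+1)) => // [|k|k /J_root].
  - by rewrite size_deriv def_n.
  - exact: spJ.
  - by rewrite !derivSn.
have : J 0%N -> root p x /\ root p^`() x by move=> /J_root.
have := birkhoff_mu_deriv x p0; have := spJ 0%N.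
(* If [p.[x] != 0] and [\mu_x p^`()] is odd, then [birkhoff_mu x p] is less by 1
   than [birkhoff_mu x p^`()]; but the latter is odd, unlike the sum. *)
have := odd_birkhoff_mu x p^`().
by case: (J 0%N) (J 1%N) (root p x) => [] [] [] /=; lia.
Qed.

End BirkhoffMultiplicity.

Lemma size_le_path_between d (T : orderType d) (C s : seq T) (a : T) :
  path (fun x y => has (fun c => x < c < y)%O C) a s -> (size s <= size C)%N.
Proof.
move=> between_s; apply: leq_trans (count_size (fun c => a < c)%O C).
elim: s a between_s => //= b s IHs a /andP[/hasP[c cC /andP[ac cb]] /IHs le_s].
have /permP eq_count := perm_to_rem cC.
move: le_s; rewrite !eq_count /= ac ltNge (ltW cb) add0n ltnS.
move/leq_trans; apply.
by apply: sub_count => x /(lt_trans (lt_trans ac cb)).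
Qed.

Section Rolle.
Variable R : rcfType.
Implicit Types (p : {poly R}) (x a b : R) (Y : seq R).

Lemma even_mu_same_sign p a b :
    p != 0 -> {in `]a, b[, forall x, ~~ odd (\mu_x p)} ->
  {in `]a, b[ &, forall x y, 0 <= p.[x] * p.[y]}.
Proof.
have [n] := ubnP (size p); elim: n p => // n IHn p lt_pn p0 even_mu x y xab yab.
have [p_noroot|[c]] : {in `]a, b[, forall c, ~~ root p c} \/
    exists2 c, c \in `]a, b[ & root p c.
- case def_r: (roots p a b) => [|c r]; [left | right; exists c].
  + exact: roots_nil def_r.
  + by apply: (@roots_in _ p); rewrite def_r mem_head.
  + by apply: (@root_roots _ p a b); rewrite def_r mem_head.
- rewrite -sgr_ge0 sgrM (polyrN0_itv p_noroot xab yab) -sgrM sgr_ge0.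
  exact: sqr_ge0.
move=> cab root_c.
have : (2 <= \mu_c p)%N.
  by have := even_mu c cab; have := mu_gt0 c p0; rewrite root_c; lia.
rewrite -root_le_mu // => /dvdpP[q pE].
have q0 : q != 0 by apply: contraNneq p0 => q0; rewrite pE q0 mul0r.
have p_horner z : p.[z] = q.[z] * (z - c) ^+ 2.
  by rewrite pE hornerM horner_exp hornerXsubC.
rewrite !p_horner mulrACA; apply: mulr_ge0; last by rewrite mulr_ge0 ?sqr_ge0.
apply: (IHn q) => //.
  move: lt_pn; rewrite pE size_Mmonic ?monic_exp ?monicXsubC //.
  by rewrite size_exp_XsubC; lia.
move=> z /even_mu; rewrite pE mu_mul -?pE // mu_exp.
by rewrite oddD oddM andbF addbF.
Qed.

Lemma rolle_odd_mu p a b :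
    a < b -> root p a -> root p b -> {in `]a, b[, forall x, ~~ root p x} ->
  exists2 c, c \in `]a, b[ & odd (\mu_c p^`()).
Proof.
move=> lt_ab root_a root_b p_noroot.
set m := (a + b) / 2%:R.
have mab : m \in `]a, b[ by rewrite mid_in_itv.
have [am mb] : a < m /\ m < b by move: mab; rewrite in_itv => /andP[].
have pm_sqr_gt0 : 0 < p.[m] ^+ 2.
  by rewrite exprn_even_gt0 //= -rootE p_noroot.
have [u uam] := poly_mvt p am; rewrite (rootP root_a) subr0 => pmE.
have [v vmb] := poly_mvt p mb; rewrite (rootP root_b) sub0r => pmNE.
have dpuv_lt0 : p^`().[u] * p^`().[v] < 0.
  rewrite -(pmulr_llt0 _ (x := (m - a) * (b - m))) ?mulr_gt0 ?subr_gt0 //.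
  by rewrite mulrACA -pmE -pmNE mulrN oppr_lt0.
have dp0 : p^`() != 0.
  by apply: contraTneq dpuv_lt0 => ->; rewrite !horner0 mul0r ltxx.
pose odd_mu c := odd (\mu_c p^`()).
have [/hasP[c]|/hasPn no_odd] := boolP (has odd_mu (roots p^`() a b)).
  by move=> /roots_in; exists c.
suff : 0 <= p^`().[u] * p^`().[v] by rewrite leNgt dpuv_lt0.
apply: (even_mu_same_sign (a := a) (b := b) dp0).
- move=> x xab; apply/negP => odd_x.
  suff /no_odd/negP : x \in roots p^`() a b by apply.
  by rewrite in_roots xab dp0 -mu_gt0 // odd_gt0.
- by move: uam; rewrite !in_itv /= => /andP[-> /lt_trans->].
- by move: vmb; rewrite !in_itv /= => /andP[/(lt_trans am)-> ->].
Qed.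

Lemma mem_rootsR p : p != 0 -> rootsR p =i root p.
Proof.
by move=> p0 x; rewrite [RHS](roots_onP (roots_on_rootsR p0)) ?in_itv.
Qed.

Lemma size_rootsR_le_odd_mu p :
  (size (rootsR p) <=
   (count (fun c => ~~ root p c && odd (\mu_c p^`())) (rootsR p^`())).+1)%N.
Proof.
rewrite -size_filter; set C := filter _ _.
suff path_C s a b x : roots p a b = x :: s ->
    path (fun y z => has (fun c => y < c < z) C) x s.
  rewrite /rootsR; case def_r: (roots p _ _) => [|x s] //=; rewrite ltnS.
  exact: size_le_path_between (path_C _ _ _ _ def_r).
elim: s a x => //= y s IHs a x /eqP.
rewrite roots_cons => /and5P[p0 _ _ root_x /eqP def_r].
rewrite (IHs _ _ def_r) andbT.
move/eqP: def_r; rewrite roots_cons => /and5P[_ xby /eqP def_xy root_y _].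
have p_noroot := roots_nil p0 def_xy.
have lt_xy : x < y by move: xby; rewrite in_itv => /andP[].
have [c cxy odd_c] := rolle_odd_mu lt_xy root_x root_y p_noroot.
have dp0 : p^`() != 0 by apply: contraTneq odd_c => ->; rewrite mu0.
apply/hasP; exists c; last by move: cxy; rewrite in_itv.
rewrite mem_filter p_noroot // odd_c.
by rewrite mem_rootsR // -[_ \in _]/(root _ _) -mu_gt0 // odd_gt0.
Qed.

Lemma sum_root_le_odd_mu p Y :
    p != 0 -> uniq Y -> {subset rootsR p^`() <= Y} ->
  (\sum_(x <- Y) root p x <=
   (\sum_(x <- Y) (~~ root p x && odd (\mu_x p^`()))).+1)%N.
Proof.
move=> p0 uY sub_Y; rewrite -count_sum.
apply: (@leq_trans (size (rootsR p))).
  rewrite -size_filter uniq_leq_size ?filter_uniq // => x.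
  by rewrite mem_filter mem_rootsR // => /andP[].
apply: leq_trans (size_rootsR_le_odd_mu p) _; rewrite ltnS -count_sum.
rewrite -!size_filter uniq_leq_size ?filter_uniq ?uniq_roots // => x.
by rewrite !mem_filter => /andP[-> /sub_Y].
Qed.

Lemma sum_birkhoff_mu_le p Y :
  p != 0 -> uniq Y -> (\sum_(x <- Y) birkhoff_mu x p <= (size p).-1)%N.
Proof.
move def_n: (size p).-1 => n; elim: n => [|n IHn] in p Y def_n *.
  move=> p0 uY; rewrite big1 // => x _.
  rewrite /birkhoff_mu def_n big_ord0 addn0.
  have /size_poly1P[c c0 ->] : size p == 1%N by rewrite polySpred ?def_n.
  exact: mu_polyC.
move=> p0 uY; pose Z := undup (Y ++ rootsR p^`()).
have uZ : uniq Z := undup_uniq _.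
have dp0 : p^`() != 0 by rewrite -size_poly_gt0 size_deriv def_n.
apply: (@leq_trans (\sum_(x <- Z) birkhoff_mu x p)).
  apply: uniq_sub_le_big => // [k m|x xY]; first exact: leq_addr.
  by rewrite mem_undup mem_cat xY.
rewrite -(leq_add2r (\sum_(x <- Z) (~~ root p x && odd (\mu_x p^`())))).
rewrite -big_split (eq_bigr _ (fun x _ => birkhoff_mu_deriv x p0)).
rewrite big_split addSnnS /=.
apply: leq_add; first by apply: IHn; rewrite // size_deriv def_n.
apply: sum_root_le_odd_mu => // x root_x.
by rewrite mem_undup mem_cat root_x orbT.
Qed.

Lemma roots_pairs_le_deg p X (T : seq (R * nat)) :
    p != 0 -> uniq X -> all (root p) X ->
    uniq T -> (forall x, spaced (column T x)) -> {in T, forall t, 0 < t.2}%N ->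
    birkhoff_root (doubled T) p ->
  (size X + 2 * count (fun t => t.2 < size p) T <= (size p).-1)%N.
Proof.
move=> p0 uX /allP X_root uT spT T_gt0 T_root; pose Y := undup (X ++ map fst T).
have uY : uniq Y := undup_uniq _.
have sXY : {subset X <= Y} by move=> x xX; rewrite mem_undup mem_cat xX.
have sTY : {subset map fst T <= Y}.
  by move=> x xT; rewrite mem_undup mem_cat xT orbT.
apply: leq_trans (sum_birkhoff_mu_le p0 uY).
apply: (@leq_trans
  (\sum_(x <- Y) (root p x + 2 * \sum_(k < size p) column T x k))).
  rewrite big_split -big_distrr leq_add ?leq_mul ?count_le_sum_column //.
  rewrite -count_sum -size_filter uniq_leq_size // => x xX.
  by rewrite mem_filter X_root ?sXY.
apply: leq_sum => x _.
have nT0 : ~~ column T x 0 by apply/negP => /T_gt0.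
have := @spaced_pairs_le_birkhoff_mu _ (column T x) x p p0 (spT x).
rewrite nT0 andbT; apply => k Txk.
split; first by apply: (allP T_root (x, k)); rewrite mem_cat [_ \in T]Txk.
apply: (allP T_root (x, k.+1)); rewrite mem_cat; apply/orP; right.
by apply/mapP; exists (x, k).
Qed.

Lemma exists_birkhoff_root_separating (K : seq (R * nat)) a b :
    a != b -> {in K, forall u, 0 < u.2}%N ->
  exists p, [/\ (size p <= (2 * size K).+2)%N, birkhoff_root K p,
    root p a & ~~ root p b].
Proof.
move=> ab K_gt0; have [T [uT sTK spT sKT]] := pair_cover K.
have [p [p0 /= /andP[root_a T_root] le_p]] :=
  exists_birkhoff_root_deg_le_count ((a, 0%N) :: doubled T).
pose pairs := count (fun t : R * nat => t.2 < size p)%N T.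
have {}le_p : ((size p).-1 <= 1 + 2 * pairs)%N.
  apply: leq_trans le_p _; rewrite /= leq_add ?leq_b1 //.
  rewrite count_cat count_map mul2n -addnn.
  by rewrite leq_add // sub_count // => t /=; lia.
exists p; split=> //.
- apply: leq_trans (leqSpred _) _; apply: leq_trans le_p _.
  rewrite ltnS leq_mul2l /= (leq_trans (count_size _ _)) //.
  exact: uniq_leq_size.
- by apply/allP => u /sKT /(allP T_root).
- apply/negP => root_b.
  have T_gt0 : {in T, forall t, 0 < t.2}%N := sub_in1 sTK K_gt0.
  have := roots_pairs_le_deg (X := [:: a; b]) p0 _ _ uT spT T_gt0 T_root.
  rewrite /= inE ab root_a root_b -/pairs => /(_ isT isT)/leq_trans/(_ le_p).
  by rewrite leq_add2r.
Qed.

End Rolle.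

Theorem theorem15 (R : realType) (d l : nat)
    (beta y : 'I_l -> R) (e : 'I_l -> nat)
    (he : forall i : 'I_l, (e i <= d)%N)
    (hH : H2 R d = \sum_(i < l) beta i *: ('X + (y i)%:P) ^+ e i) :
  (d%:R - 1) / 2%:R < l%:R :> R.
Proof.
suff lt_dl : (d < 2 * l)%N.
  by rewrite ltr_pdivrMr ?ltr0n // ltrBlDr -natrM natr1 ltr_nat; lia.
rewrite ltnNge; apply/negP => le_ld.
pose K := [seq (y i, (d.+1 - e i)%N) | i : 'I_l].
have K_gt0 : {in K, forall u, 0 < u.2}%N.
  by move=> u /mapP[i _ ->] /=; have := he i; lia.
have [p [le_p K_root root1 nroot0]] :=
  exists_birkhoff_root_separating (oner_neq0 R) K_gt0.
have horner10 : p.[1] = p.[0].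
  apply: (@eq_horner_shifted_powers _ _ d.+1 _ _ beta y e) => [|i||i].
  - by rewrite polyC1 addr0 -hH.
  - exact: leqW (he i).
  - by rewrite (leq_trans le_p) // size_map size_enum_ord.
  - by apply: (allP K_root (_, _)); rewrite map_f ?mem_enum.
by case/negP: nroot0; rewrite rootE -horner10.
Qed.
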